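(* Let $q=p^m$ be a power of a prime $p$, let $k,T$ be integers with $0\le T<k$, let $\theta(\alpha)=\alpha^{q^T}$ on $\mathbb{F}_{q^k}$, and let $n=n_0p^r$ with $r\ge 0$ and $n_0\geq 1$, $\gcd(n_0,p)=1$. A cyclic code $C=\langle g(x)\rangle$ of length $n$ over $\mathbb{F}_{q^k}$ with generator polynomial $g(x)$ is Galois LCD (that is, $\theta$-LCD) if and only if $$g(x)=\left(\prod_{Q\in J_1} f_Q(x)^{p^r}\right)\left(\prod_{Q\in J_2} F_Q(x)^{p^r}\right)$$ for some subsets $J_1\subseteq \Omega_1$ and $J_2\subseteq \Omega_2$. Consequently, the number of Galois LCD cyclic codes of length $n$ over $\mathbb{F}_{q^k}$ is $2^{|\Omega_1|+|\Omega_2|}$.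
   Context: Cyclic codes of length $n$ over $\mathbb{F}_{q^k}$ are identified with ideals of $\mathbb{F}_{q^k}[x]/\langle x^n-1\rangle$ via $(c_0,\dots,c_{n-1})\mapsto\sum c_ix^i$; each is $\langle g(x)\rangle$ for a unique monic divisor $g(x)$ of $x^n-1$, its generator polynomial. The $\theta$-form on $\mathbb{F}_{q^k}^n$ is $[u,v]_\theta=\sum_{i=0}^{n-1}u_i\theta(v_i)$, and $C^{\perp_\theta}=\{v\in\mathbb{F}_{q^k}^n:[v,c]_\theta=0\text{ for all }c\in C\}$. The code $C$ is Galois LCD ($\theta$-LCD) if $C\cap C^{\perp_\theta}=\{0\}$. The $q^k$-cyclotomic class of $i\in\mathbb{Z}_{n_0}$ is $\{q^{kj}i\bmod n_0:j\ge0\}$. Fix a primitive $n_0$th root of unity $\zeta$ in an extension of $\mathbb{F}_{q^k}$ and set $f_Q(x)=\prod_{i\in Q}(x-\zeta^i)$ for each $q^k$-cyclotomic class $Q\subseteq\mathbb{Z}_{n_0}$; these are the monic irreducible factors of $x^{n_0}-1$ over $\mathbb{F}_{q^k}$. Let $\sigma$ be the permutation $\sigma(Q)=-q^TQ=\{-q^Ti\bmod n_0:i\in Q\}$ of the set of $q^k$-cyclotomic classes modulo $n_0$, and let $\mathcal{O}(Q)$ be the $\sigma$-orbit of $Q$. Choose one representative in each $\sigma$-orbit; $\Omega_1$ is the set of representatives of the orbits of size $1$, and $\Omega_2$ is the set of representatives of the orbits of size greater than $1$. For $Q\in\Omega_2$, $F_Q(x)=\prod_{R\in\mathcal{O}(Q)}f_R(x)$.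 *)

(* Defs.v *)
From HB Require Import structures.
From mathcomp Require Import all_boot all_order all_algebra.

Set Implicit Arguments.
Unset Strict Implicit.
Unset Printing Implicit Defensive.

Import GRing.Theory.
Local Open Scope ring_scope.

(* Z/n as an additive group.  For 0 < n this is 'I_n; unlike 'Z_n it is the
   trivial group when n = 1. *)
Notation residue n := ('I_n.-1.+1).

Section Codes.

Variables (F : finFieldType) (n : nat).
Implicit Types (C : {set 'rV[F]_n}) (u v c : 'rV[F]_n) (g : {poly F}).

Definition linear_code C : bool :=
  (0 \in C) && [forall a : F, forall u in C, forall v in C, a *: u + v \in C].

(* (c_0, ..., c_(n-1)) |-> (c_(n-1), c_0, ..., c_(n-2)) *)
Definition cyclic_shift c : 'rV[F]_n := \row_i c 0 (ord_pred i).

Definition cyclic_code C : bool :=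
  linear_code C && [forall c in C, cyclic_shift c \in C].

(* The ideal <g> of F[x]/(x^n - 1): a vector stands for the class of the
   polynomial rVpoly c = \sum_i c_i x^i, and every class has exactly one such
   representative of degree < n. *)
Definition ideal_code g : {set 'rV[F]_n} :=
  [set poly_rV ((rVpoly a * g) %% ('X^n - 1)) | a : 'rV[F]_n].

Definition generator_poly C g : Prop :=
  [/\ g \is monic, g %| 'X^n - 1 & C = ideal_code g].

Variable theta : F -> F.

Definition theta_form u v : F := \sum_(i < n) u 0 i * theta (v 0 i).

Definition theta_dual C : {set 'rV[F]_n} :=
  [set v | [forall c in C, theta_form v c == 0]].

Definition theta_LCD C : bool := C :&: theta_dual C == [set 0].

End Codes.

Definition frob (F : finFieldType) (q T : nat) (alpha : F) : F :=
  alpha ^+ (q ^ T).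

Section Cyclotomic.

Variables (q k T n0 : nat).
Implicit Types (Q : {set residue n0}) (Omega : {set {set residue n0}}).

Definition cyclotomic_class (i : residue n0) : {set residue n0} :=
  [set j in orbit (fun i' : residue n0 => i' *+ (q ^ k)) i].

Definition cyclotomic_classes : {set {set residue n0}} :=
  [set cyclotomic_class i | i : residue n0].

Definition sigma Q : {set residue n0} := [set - (i *+ (q ^ T)) | i in Q].

Definition sigma_orbit Q : {set {set residue n0}} := [set R in orbit sigma Q].

Definition orbit_representatives Omega : bool :=
  (Omega \subset cyclotomic_classes) &&
  [forall Q in cyclotomic_classes, #|Omega :&: sigma_orbit Q| == 1%N].

Definition Omega1 Omega : {set {set residue n0}} :=
  [set Q in Omega | #|sigma_orbit Q| == 1%N].

Definition Omega2 Omega : {set {set residue n0}} :=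
  [set Q in Omega | (1 < #|sigma_orbit Q|)%N].

Variables (L : fieldType) (zeta : L).

Definition f_ Q : {poly L} := \prod_(i in Q) ('X - (zeta ^+ i)%:P).

Definition F_ Q : {poly L} := \prod_(R in sigma_orbit Q) f_ R.

End Cyclotomic.

(* Main.v *)
Require Import Defs.
From HB Require Import structures.
From mathcomp Require Import all_boot all_order all_algebra.
From mathcomp Require Import finfield.

Set Implicit Arguments.
Unset Strict Implicit.
Unset Printing Implicit Defensive.

Import GRing.Theory.
Local Open Scope ring_scope.

(** Let tau be the ring endomorphism of F[x]/(x^n - 1) that applies theta to
    the coefficients and sends x to x^-1.  The theta-form of u and v is the
    constant coefficient of u * tau(v), and an ideal is stable under
    multiplication by x; so the theta-dual of <g> consists of the u such that
    u * tau(g) = 0 ([mem_theta_dual_ideal]).  Writing x^n - 1 = g * h, an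
    element a * g of <g> lies in the dual iff h divides a * tau(g), and it
    vanishes iff h divides a.  Hence <g> is LCD iff h and tau(g) are coprime
    ([theta_LCD_coprime]).

    Over L all the roots of x^n - 1 are powers of zeta, with multiplicity p^r,
    and tau(g) vanishes at zeta^s(i), where s(i) = - q^T i, iff g vanishes at
    zeta^i.  Coprimality therefore says that no zero zeta^i of g is such that
    zeta^s(i) is a zero of h.  Then zeta^s(i) has its full multiplicity p^r in
    g; so the set S of the exponents of the zeros of g is mapped into itself by
    s, and since s is a permutation, s(S) = S.  Every zero of g is
    thus a zero of multiplicity p^r, and g is the p^r-th power of the product
    of the x - zeta^i for i in S ([closed_roots_factor],
    [theta_LCD_defining_set]).

    As g has coefficients in F, S is also stable under multiplication by q^k,
    and conversely each S that is stable in this sense comes from a polynomial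
    over F ([f_descent]).  The sets S that are stable under both maps are the
    unions of sigma-orbits of cyclotomic classes, and they correspond to the
    subsets of Omega ([closed_orbit_union], [sub_orbit_union]).  This gives the
    factorization of g, and also the number of codes, because each cyclic code
    has exactly one generator polynomial ([cyclic_code_generator],
    [ideal_code_inj]). *)

(** * Cyclic codes as ideals of F[x]/(x^n - 1) *)

Section CyclicCodes.

Variables (F : finFieldType) (n : nat).
Hypothesis n_gt0 : (0 < n)%N.
Implicit Types (C : {set 'rV[F]_n}) (u v c : 'rV[F]_n) (a b g h : {poly F}).

Let G : {poly F} := 'X^n - 1.

Let size_G : size G = n.+1.
Proof. exact: size_Xn_sub_1. Qed.

Let G_neq0 : G != 0.
Proof. by rewrite -size_poly_gt0 size_G. Qed.

Let size_modG a : (size (a %% G)%R <= n)%N.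
Proof. by rewrite -ltnS -size_G ltn_modp. Qed.

Lemma rVpoly_poly_rV_mod a : rVpoly (poly_rV (a %% G) : 'rV_n) = a %% G.
Proof. exact: poly_rV_K. Qed.

Lemma rVpoly_mod v : rVpoly v %% G = rVpoly v.
Proof. by rewrite modp_small // size_G ltnS size_poly. Qed.

Lemma dvd_rVpoly_eq0 v : (G %| rVpoly v) = (v == 0).
Proof.
rewrite /dvdp rVpoly_mod; apply/eqP/eqP => [v0|->]; last by rewrite linear0.
by rewrite -(rVpolyK v) v0 linear0.
Qed.

(** Since g divides x^n - 1, reduction modulo x^n - 1 preserves divisibility by
    g.  This replaces the quotient ring by divisibility in F[x] from here on. *)
Lemma mem_ideal_code g v :
  g %| G -> (v \in ideal_code n g) = (g %| rVpoly v).
Proof.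
move=> dvd_gG; apply/imsetP/idP => [[a _ ->]|/dvdpP[b def_v]].
  by rewrite rVpoly_poly_rV_mod -dvdp_mod // dvdp_mull.
have g_neq0 : g != 0 by apply: contraTneq dvd_gG => ->; rewrite dvd0p.
exists (poly_rV b) => //; rewrite poly_rV_K; last first.
  have [->|b_neq0] := eqVneq b 0; first by rewrite size_poly0.
  apply: leq_trans (size_poly _ _ : (size (rVpoly v) <= n)%N).
  have g_gt0 : (0 < size g)%N by rewrite size_poly_gt0.
  by rewrite def_v size_mul // -(prednK g_gt0) addnS leq_addr.
by rewrite -def_v rVpoly_mod rVpolyK.
Qed.

(** The generator polynomial is determined by the code: g reduced modulo
    x^n - 1 is itself a codeword of <g>, so two generators of the same code
    divide each other. *)
Lemma ideal_code_inj g h : g \is monic -> h \is monic -> g %| G -> h %| G ->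
  ideal_code n g = ideal_code n h -> g = h.
Proof.
move=> mon_g mon_h dvd_g dvd_h eq_gh; apply/eqP; rewrite -eqp_monic //.
have dvd_of a b : a %| G -> b %| G -> ideal_code n a = ideal_code n b -> b %| a.
  move=> da db eq_ab; rewrite (dvdp_mod _ db) -rVpoly_poly_rV_mod.
  rewrite -mem_ideal_code // -eq_ab mem_ideal_code //.
  by rewrite rVpoly_poly_rV_mod -dvdp_mod.
by rewrite /eqp; apply/andP; split; apply: dvd_of.
Qed.

(** If b has degree less than n, then x * b has degree at most n, and reducing
    it only folds its coefficient of degree n back to degree 0. *)
Lemma modp_mulX a :
  ('X * a) %% G = 'X * (a %% G) - (a %% G)`_n.-1 *: G.
Proof.
rewrite -modp_mul; set b := a %% G; set r := RHS.
rewrite -(subrK (b`_n.-1 *: G) ('X * b)) -/r modpD modpZl modpp scaler0 addr0.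
rewrite modp_small // size_G ltnS; apply/leq_sizeP => j le_nj.
rewrite /r coefB coefXM coefZ coefB coefXn coef1.
rewrite (gtn_eqF (leq_trans n_gt0 le_nj)) mulr0n subr0.
case: eqVneq => [->|neq_jn]; first by rewrite mulr1 subrr.
have lt_nj : (n < j)%N by rewrite ltn_neqAle eq_sym neq_jn.
rewrite mulr0 subr0 nth_default // (leq_trans (size_modG _)) //.
by rewrite -ltnS prednK // (leq_trans n_gt0).
Qed.

Lemma rVpoly_cyclic_shift c : rVpoly (cyclic_shift c) = ('X * rVpoly c) %% G.
Proof.
rewrite modp_mulX rVpoly_mod; apply/polyP => j.
rewrite coefB coefXM coefZ coefB coefXn coef1.
rewrite (coef_rVpoly (cyclic_shift c)); case: insubP => [i _ <-|].
  rewrite mxE -coef_rVpoly_ord /= (ltn_eqF (ltn_ord i)) sub0r mulrN.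
  case: (posnP i) => [->|i_gt0].
    by rewrite mulr1 opprK add0r add0n modn_small ?prednK.
  rewrite mulr0 oppr0 subr0 -(prednK i_gt0) addSn /= modnDr modn_small //.
  by rewrite (leq_ltn_trans (leq_pred _)).
rewrite -leqNgt => le_nj; have j_gt0 := leq_trans n_gt0 le_nj.
rewrite (gtn_eqF j_gt0) mulr0n subr0.
case: eqVneq => [->|neq_jn]; first by rewrite mulr1 subrr.
rewrite mulr0 subr0 nth_default // (leq_trans (size_poly _ _)) //.
by rewrite -ltnS prednK // ltn_neqAle eq_sym neq_jn.
Qed.

Lemma ideal_code_cyclic g : g %| G -> cyclic_code (ideal_code n g).
Proof.
move=> dvd_gG; apply/andP; split; first (apply/andP; split).
- by rewrite mem_ideal_code // linear0 dvdp0.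
- apply/forallP => a; apply/forall_inP => u gu; apply/forall_inP => v.
  move: gu; rewrite !mem_ideal_code // linearP /= => gu gv.
  by rewrite dvdp_add // -mul_polyC dvdp_mull.
apply/forall_inP => c; rewrite !mem_ideal_code // rVpoly_cyclic_shift => gc.
by rewrite -dvdp_mod // dvdp_mull.
Qed.

(** ** Generator polynomials *)

Section CyclicIdeal.

Variable C : {set 'rV[F]_n}.
Hypothesis cycC : cyclic_code C.

Let in_ideal a := poly_rV (a %% G) \in C.

Let ideal0 : in_ideal 0.
Proof. by rewrite /in_ideal mod0p linear0; case/andP: cycC => /andP[]. Qed.

Let ideal_lin (c : F) a b : in_ideal a -> in_ideal b -> in_ideal (c *: a + b).
Proof.
rewrite /in_ideal modpD modpZl linearP => Ca Cb.
have /andP[/andP[_ /forallP/(_ c)/forall_inP linC] _] := cycC.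
by have /forall_inP := linC _ Ca; apply.
Qed.

Let idealX a : in_ideal a -> in_ideal ('X * a).
Proof.
have /andP[_ /forall_inP shiftC] := cycC.
move/shiftC; congr (_ \in C).
apply: (can_inj rVpolyK).
by rewrite rVpoly_cyclic_shift !rVpoly_poly_rV_mod modp_mul.
Qed.

Let idealM a b : in_ideal b -> in_ideal (a * b).
Proof.
move=> Ib; elim/poly_ind: a => [|a c IHa]; first by rewrite mul0r.
by rewrite mulrDl addrC mul_polyC -mulrA mulrCA; apply/ideal_lin/idealX.
Qed.

(** The generator is the gcd of x^n - 1 and of all the codewords: by Bezout it
    is a combination of elements of the ideal of the code. *)
Lemma cyclic_code_generator : exists g, generator_poly C g.
Proof.
pose d := \big[@gcdp F/G]_(c <- enum C) rVpoly c.
have Id : in_ideal d.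
  rewrite /d big_seq; elim/big_ind: _ => [|a b Ia Ib|c].
  - by have:= ideal0; rewrite /in_ideal modpp mod0p.
  - have [[u v] /= /eqpP[[x y] /= /andP[x0 y0] def_gcd]] := Bezoutp a b.
    have ->: gcdp a b = y^-1 *: (x *: (u * a + v * b)) + 0.
      by rewrite addr0 def_gcd scalerA mulVf // scale1r.
    apply: ideal_lin ideal0; rewrite -[_ *: _]addr0; apply: ideal_lin ideal0.
    by rewrite -[u * a]scale1r; apply: ideal_lin; apply: idealM.
  by rewrite mem_enum /in_ideal rVpoly_mod rVpolyK.
have dvd_d c : c \in C -> d %| rVpoly c.
  move=> Cc; rewrite /d; have: c \in enum C by rewrite mem_enum.
  elim: (enum _) => // x s IHs; rewrite inE big_cons => /orP[/eqP->|/IHs].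
    exact: dvdp_gcdl.
  exact/dvdp_trans/dvdp_gcdr.
have dvd_dG : d %| G.
  rewrite /d; elim: (enum _) => [|x s IHs]; rewrite ?big_nil //.
  by rewrite big_cons; apply: dvdp_trans IHs; apply: dvdp_gcdr.
have d_neq0 : lead_coef d != 0.
  by rewrite lead_coef_eq0; apply: contraTneq dvd_dG => ->; rewrite dvd0p.
have eq_d : (lead_coef d)^-1 *: d %= d by rewrite eqp_scale ?invr_eq0.
exists ((lead_coef d)^-1 *: d); split.
- by rewrite monicE lead_coefZ mulVf.
- by rewrite (eqp_dvdl _ eq_d).
apply/setP => c; rewrite mem_ideal_code ?(eqp_dvdl _ eq_d) //.
apply/idP/idP => [/dvd_d //|/dvdpP[a def_c]].
by rewrite -(rVpolyK c) -rVpoly_mod def_c; apply: idealM.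
Qed.

End CyclicIdeal.

(** * The dual code and the coprimality criterion *)

Section Dual.

Variable theta : {rmorphism F -> F}.

(** Modulo x^n - 1, where x^(n-1) is the inverse of x, this is the ring
    endomorphism that acts by theta on coefficients and sends x to x^-1. *)
Definition conj_rev a : {poly F} := map_poly theta a \Po 'X^(n.-1).

Lemma conj_revM a b : conj_rev (a * b) = conj_rev a * conj_rev b.
Proof. by rewrite /conj_rev rmorphM comp_polyM. Qed.

Let dvd_Xn_sub1 d : G %| 'X^(n * d) - 1.
Proof.
elim: d => [|d IHd]; first by rewrite muln0 expr0 subrr dvdp0.
have ->: 'X^(n * d.+1) - 1 = 'X^(n * d) * G + ('X^(n * d) - 1) :> {poly F}.
  by rewrite mulrBr mulr1 -exprD addnC -mulnS addrA subrK.
by rewrite dvdp_add // dvdp_mull.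
Qed.

Let conj_rev_mod a b : (b * conj_rev (a %% G)) %% G = (b * conj_rev a) %% G.
Proof.
rewrite {2}(divp_eq a G) /conj_rev rmorphD rmorphM /= comp_polyD comp_polyM.
rewrite mulrDr modpD [X in _ = X + _]modp_eq0 ?add0r //.
rewrite rmorphB /= map_polyXn rmorph1 comp_polyB comp_Xn_poly comp_polyC -exprM.
by rewrite mulrA mulrC dvdp_mulr // mulnC dvd_Xn_sub1.
Qed.

Let coef0_mulX_pred a j : (j < n)%N ->
  ((a * 'X^(n.-1 * j)) %% G)`_0 = (a %% G)`_j.
Proof.
have coef0_mulX b i : (i < n)%N -> (('X^i * b) %% G)`_i = (b %% G)`_0.
  elim: i => [|i IHi] lt_in; first by rewrite mul1r.
  rewrite exprS -mulrA modp_mulX coefB coefXM coefZ coefB coefXn coef1 /=.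
  by rewrite (ltn_eqF lt_in) subrr mulr0 subr0 IHi // ltnW.
move=> lt_jn; rewrite -(coef0_mulX _ j) // mulrCA -exprD -mulSn prednK //.
rewrite -{1}(subrK 1 'X^(n * j)) mulrDr mulr1 modpD.
by rewrite [X in X + _]modp_eq0 ?add0r // dvdp_mull.
Qed.

(** By linearity it suffices to take v = x^j.  Then u * x^-j has constant
    coefficient u_j. *)
Lemma theta_form_coef0 u v :
  theta_form theta u v = ((rVpoly u * conj_rev (rVpoly v)) %% G)`_0.
Proof.
have ->: conj_rev (rVpoly v) = \sum_(j < n) theta (v 0 j) *: 'X^(n.-1 * j).
  rewrite {1}/rVpoly poly_def /conj_rev rmorph_sum linear_sum.
  apply: eq_bigr => j _ /=.
  rewrite map_polyZ map_polyXn linearZ /= comp_Xn_poly -exprM.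
  by rewrite insubT // => lt_jn; congr (theta (v 0 _) *: _); apply: val_inj.
rewrite mulr_sumr.
apply: (big_rec2 (fun x y => x = (y %% G)`_0)) => [|j x y _ IH].
  by rewrite mod0p coef0.
rewrite modpD coefD -IH -scalerAr modpZl coefZ coef0_mulX_pred //.
by rewrite rVpoly_mod coef_rVpoly_ord mulrC.
Qed.

(** The codeword x^j * g pairs with u to the j-th coefficient of u * tau(g),
    so orthogonality to the n shifts of g already forces u * tau(g) = 0. *)
Lemma mem_theta_dual_ideal g u : g %| G ->
  (u \in theta_dual theta (ideal_code n g)) = (G %| rVpoly u * conj_rev g).
Proof.
move=> dvd_gG; rewrite inE; apply/forall_inP/idP => [u_dual|].
  apply/eqP/polyP => j; rewrite coef0.
  have [le_nj|lt_jn] := leqP n j.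
    by rewrite nth_default // (leq_trans (size_modG _)).
  pose c : 'rV[F]_n := poly_rV (('X^j * g) %% G).
  have Cc : c \in ideal_code n g.
    by rewrite mem_ideal_code // rVpoly_poly_rV_mod -dvdp_mod // dvdp_mull.
  have /eqP := u_dual _ Cc.
  rewrite theta_form_coef0 rVpoly_poly_rV_mod conj_rev_mod conj_revM.
  rewrite /conj_rev map_polyXn comp_Xn_poly -exprM -/(conj_rev g).
  by rewrite mulrCA mulrC coef0_mulX_pred.
move=> dvd_ug c; rewrite mem_ideal_code // => /dvdpP[a def_c].
rewrite theta_form_coef0 def_c conj_revM mulrCA.
by rewrite modp_eq0 ?coef0 // dvdp_mull.
Qed.

(** With x^n - 1 = h * g, a common factor d of h and tau(g) yields the
    codeword (h / d) * g, which is orthogonal to <g> and is nonzero unless d is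
    constant. *)
Lemma theta_LCD_coprime g : g %| G ->
  theta_LCD theta (ideal_code n g) = coprimep (G %/ g) (conj_rev g).
Proof.
move=> dvd_gG; set h := G %/ g.
have def_G : G = h * g by rewrite divpK.
have /andP[h_neq0 g_neq0] : (h != 0) && (g != 0).
  by rewrite -negb_or -mulf_eq0 -def_G.
rewrite /theta_LCD; apply/eqP/idP => [LCD_g|co_hg].
  set d := gcdp h (conj_rev g).
  have def_h : h = h %/ d * d by rewrite divpK ?dvdp_gcdl.
  have hd_neq0 : h %/ d != 0.
    by apply: contraNneq h_neq0 => h0; rewrite def_h h0 mul0r.
  have: poly_rV ((h %/ d * g) %% G) \in [set (0 : 'rV[F]_n)].
    rewrite -LCD_g inE mem_ideal_code // mem_theta_dual_ideal //.
    rewrite !rVpoly_poly_rV_mod -dvdp_mod // dvdp_mull //=.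
    rewrite /dvdp mulrC modp_mul -/(dvdp _ _) mulrA {1}def_G dvdp_mul2r //.
    by rewrite {1}def_h [conj_rev g * _]mulrC dvdp_mul2l ?dvdp_gcdr.
  rewrite inE -dvd_rVpoly_eq0 rVpoly_poly_rV_mod -dvdp_mod //.
  rewrite {1}def_G dvdp_mul2r // => dvd_h.
  have: d %| 1.
    by rewrite -(dvdp_mul2l _ _ hd_neq0) mulr1 -def_h.
  by rewrite dvdp1.
apply/setP => v.
rewrite in_setI in_set1 mem_ideal_code // mem_theta_dual_ideal //.
rewrite -dvd_rVpoly_eq0; apply/andP/idP => [[/dvdpP[a ->]]|dvd_v].
  by rewrite mulrAC def_G !dvdp_mul2r // Gauss_dvdpl.
by rewrite (dvdp_trans dvd_gG) ?dvdp_mulr.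
Qed.

End Dual.

End CyclicCodes.

(** * Polynomials whose roots are powers of zeta *)

Lemma residue_mulrn_inj n0 u : (0 < n0)%N -> coprime u n0 ->
  injective (fun i : residue n0 => i *+ u).
Proof.
case: n0 => // n0 _ co_u i j /= /eqP; rewrite -subr_eq0 -mulrnBl => /eqP ij0.
apply/eqP; rewrite -subr_eq0; move: (i - j) ij0 => x; rewrite Zp_mulrn.
move/(congr1 val) => /= /eqP; rewrite -/(dvdn _ _) Gauss_dvdl 1?coprime_sym //.
by rewrite /dvdn modn_small.
Qed.

Lemma root_pexp (R : idomainType) (g : {poly R}) N x :
  (0 < N)%N -> root (g ^+ N) x = root g x.
Proof. by move=> N_gt0; rewrite !rootE horner_exp expf_eq0 N_gt0. Qed.

(** Raising to the power p^e is needed as a ring morphism on F, on L and on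
    L[x]; it is the e-fold iterate of the Frobenius endomorphism. *)
Lemma power_rmorphism (R : comNzRingType) p e : p \in [pchar R] ->
  exists phi : {rmorphism R -> R}, forall x, phi x = x ^+ (p ^ e).
Proof.
move=> pR; elim: e => [|e [phi phiE]].
  by exists idfun => x; rewrite expr1.
exists (GRing.pFrobenius_aut pR \o phi) => x /=.
by rewrite phiE pFrobenius_autE -exprM expnSr.
Qed.

Section SplitRoots.

Variables (L : fieldType) (n0 : nat) (zeta : L).
Hypothesis zeta_prim : n0.-primitive_root zeta.
Implicit Types (i j : residue n0) (S : {set residue n0}) (N : nat).

Let n0_gt0 : (0 < n0)%N := prim_order_gt0 zeta_prim.

Lemma zeta_mulrn i u : zeta ^+ (i *+ u)%R = (zeta ^+ i) ^+ u.
Proof.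
rewrite -exprM -(prim_expr_mod zeta_prim (i * u)); congr (_ ^+ _).
by case: (n0) n0_gt0 i => // n _ i; rewrite Zp_mulrn.
Qed.

Lemma zeta_opp i : zeta ^+ (- i)%R = (zeta ^+ i)^-1.
Proof.
have zi_neq0 : zeta ^+ i != 0.
  by rewrite expf_neq0 // (prim_root_eq0 zeta_prim) -lt0n.
apply: (mulIf zi_neq0); rewrite mulVf // -exprD.
rewrite -(expr0 zeta); apply/eqP; rewrite (eq_prim_root_expr zeta_prim).
have /(congr1 val) := addNr i.
by case: (n0) n0_gt0 i {zi_neq0} => // n _ i /= ->; rewrite mod0n.
Qed.

Lemma zeta_inj : injective (fun i => zeta ^+ i).
Proof.
move=> i j /eqP; rewrite (eq_prim_root_expr zeta_prim) => eq_ij.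
apply/val_inj/eqP.
by case: (n0) n0_gt0 i j eq_ij => // n _ i j; rewrite !modn_small.
Qed.

Lemma f_setT : f_ zeta [set: residue n0] = 'X^n0 - 1.
Proof.
rewrite -(factor_Xn_sub_1 zeta_prim) /f_ big_mkord.
by case: (n0) n0_gt0 => // n _; apply: eq_bigl => i; rewrite inE.
Qed.

Lemma root_f S i : root (f_ zeta S) (zeta ^+ i) = (i \in S).
Proof.
rewrite /f_ rootE horner_prod prodf_seq_eq0; apply/hasP/idP => [[j _]|Si].
  by rewrite !hornerE subr_eq0 => /andP[Sj /eqP/zeta_inj->].
by exists i; rewrite ?mem_index_enum // Si !hornerE subrr.
Qed.

Lemma f_monic S : f_ zeta S \is monic.
Proof. by apply: monic_prod => i _; apply: monicXsubC. Qed.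

Lemma f_compl S : f_ zeta S * f_ zeta (~: S) = f_ zeta [set: residue n0].
Proof.
rewrite /f_ [RHS](bigID (mem S)) /=.
by congr (_ * _); apply: eq_bigl => i; rewrite !inE.
Qed.

Lemma coprimep_fX (g : {poly L}) S N :
  {in S, forall i, ~~ root g (zeta ^+ i)} -> coprimep g (f_ zeta S ^+ N).
Proof.
move=> g_S; apply: coprimep_expr; rewrite /f_.
elim/big_rec: _ => [|i x Si IH]; first exact: coprimep1.
by rewrite coprimepMr IH coprimep_XsubC g_S.
Qed.

(** The common divisor of h and g also divides a product of the x - zeta^i,
    but it vanishes at no zeta^i. *)
Lemma coprimep_zeta (g h : {poly L}) N : h %| f_ zeta [set: residue n0] ^+ N ->
  (forall i, root h (zeta ^+ i) -> ~~ root g (zeta ^+ i)) -> coprimep h g.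
Proof.
move=> dvd_h no_root; rewrite -gcdp_eqp1; set d := gcdp h g.
have co_d : coprimep d (f_ zeta [set: residue n0] ^+ N).
  apply: coprimep_fX => i _; rewrite root_gcd.
  by apply/negP => /andP[/no_root/negbTE->].
have: coprimep d d.
  by rewrite (coprimep_dvdl _ co_d) // (dvdp_trans (dvdp_gcdl _ _)).
by rewrite coprimepp -size_poly_eq1.
Qed.

(** In the direct implication, the exponents of the zeros of g form a set S
    that s maps into itself, hence onto itself because s is injective.  So no
    zeta^i with i in s(S) = S is a zero of h, and the whole S-part of the
    factorization belongs to g. *)
Lemma closed_roots_factor (s : residue n0 -> residue n0) (g h : {poly L}) N :
    injective s -> (0 < N)%N -> g \is monic ->
    g * h = f_ zeta [set: residue n0] ^+ N ->
  (forall i, root g (zeta ^+ i) -> ~~ root h (zeta ^+ s i)) <->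
  exists2 S : {set residue n0}, {in S, forall i, s i \in S} &
    g = f_ zeta S ^+ N.
Proof.
move=> s_inj N_gt0 mon_g def_gh; split=> [no_root | [S sS def_g] i].
  pose S := [set i : residue n0 | root g (zeta ^+ i)].
  have sS : {in S, forall i, s i \in S}.
    move=> i; rewrite !inE => /no_root; apply: contraNT => not_g.
    have: root (g * h) (zeta ^+ s i) by rewrite def_gh root_pexp // root_f inE.
    by rewrite rootM (negbTE not_g).
  have imS : s @: S = S.
    apply/eqP; rewrite eqEcard card_imset // leqnn andbT.
    by apply/subsetP => _ /imsetP[i Si ->]; apply: sS.
  exists S => //; apply/eqP; rewrite -eqp_monic ?monic_exp ?f_monic //.
  apply/andP; split.
    have co_g : coprimep g (f_ zeta (~: S) ^+ N).
      by apply: coprimep_fX => i; rewrite !inE.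
    by rewrite -(Gauss_dvdpl _ co_g) -exprMn f_compl -def_gh dvdp_mulr.
  have co_h : coprimep (f_ zeta S ^+ N) h.
    rewrite coprimep_sym; apply: coprimep_fX => i.
    by rewrite -imS => /imsetP[j]; rewrite inE => /no_root/[swap]->.
  by rewrite -(Gauss_dvdpl _ co_h) def_gh -(f_compl S) exprMn dvdp_mulr.
have def_h : h = f_ zeta (~: S) ^+ N.
  by apply: (mulfI (monic_neq0 mon_g)); rewrite def_gh def_g -exprMn f_compl.
by rewrite def_g def_h !root_pexp // !root_f inE negbK; apply: sS.
Qed.

End SplitRoots.

(** * Zeros of codes and the action of the Frobenius maps *)

Section DefiningSets.

Variables (p d : nat) (F : finFieldType) (L : fieldType).
Variables (iota : {rmorphism F -> L}) (n0 : nat) (zeta : L).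
Hypotheses (p_prime : prime p) (cardF : #|F| = (p ^ d)%N).
Hypotheses (zeta_prim : n0.-primitive_root zeta) (co_p_n0 : coprime p n0).
Implicit Types (g h : {poly F}) (i : residue n0) (S : {set residue n0}).

Let n0_gt0 : (0 < n0)%N := prim_order_gt0 zeta_prim.
Let pcharL : p \in [pchar L].
Proof. by rewrite (fmorph_pchar iota) (card_finPcharP cardF). Qed.

Lemma Xn_sub1_f r :
  'X^(n0 * p ^ r) - 1 = f_ zeta [set: residue n0] ^+ (p ^ r).
Proof.
have pcharP : p \in [pchar {poly L}] by rewrite pchar_poly.
have [phi phiE] := power_rmorphism r pcharP.
by rewrite exprM -!phiE f_setT // rmorphB rmorph1.
Qed.

(** The map y |-> y^#|F| fixes the coefficients of g, so it permutes the
    zeros of g. *)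
Lemma root_map_mulrn_card g i :
  root (map_poly iota g) (zeta ^+ i) ->
  root (map_poly iota g) (zeta ^+ (i *+ #|F|)%R).
Proof.
have [phi phiE] := power_rmorphism d pcharL.
have fix_g : map_poly phi (map_poly iota g) = map_poly iota g.
  rewrite -map_poly_comp; apply: eq_map_poly => a /=.
  by rewrite phiE -cardF -rmorphXn /= expf_card.
rewrite !rootE zeta_mulrn // cardF -phiE -{2}fix_g horner_map => /eqP->.
by rewrite rmorph0.
Qed.

(** The elements of F are #|F| roots of 'X^#|F| - 'X, hence all of them. *)
Lemma fixed_power_card (y : L) : y ^+ #|F| = y -> exists a, iota a = y.
Proof.
move=> y_fix; have /(congr1 (map_poly iota)) := finField_genPoly F.
rewrite rmorphB /= map_polyXn map_polyX rmorph_prod /=.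
move/(congr1 (horner^~ y)); rewrite !hornerE y_fix subrr horner_prod.
move/esym/eqP; rewrite prodf_seq_eq0 => /hasP[a _ /=].
by rewrite rmorphB /= map_polyX map_polyC !hornerE subr_eq0 => /eqP->; exists a.
Qed.

(** The map y |-> y^#|F| permutes the linear factors, so it fixes the
    coefficients of the product, which therefore lie in F. *)
Lemma f_descent S : {in S, forall i, i *+ #|F| \in S} ->
  exists g, map_poly iota g = f_ zeta S.
Proof.
move=> closedS; pose m i := i *+ #|F|.
have m_inj : injective m.
  by apply: residue_mulrn_inj; rewrite // cardF coprimeXl.
have mS : m @: S = S.
  apply/eqP; rewrite eqEcard card_imset // leqnn andbT.
  by apply/subsetP => _ /imsetP[i Si ->]; apply: closedS.
have [phi phiE] := power_rmorphism d pcharL.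
have fix_f : map_poly phi (f_ zeta S) = f_ zeta S.
  rewrite /f_ -{2}mS big_imset /=; last exact: in2W m_inj.
  rewrite rmorph_prod; apply: eq_bigr => i _ /=.
  by rewrite rmorphB /= map_polyX map_polyC /= phiE -cardF zeta_mulrn.
pose inv y := odflt 0 [pick a | iota a == y].
have inv_iota a : inv (iota a) = a.
  rewrite /inv; case: pickP => [b /eqP/fmorph_inj //|/(_ a)].
  by rewrite eqxx.
have inv0 : inv 0 = 0 by rewrite -(rmorph0 iota) inv_iota.
exists (map_poly inv (f_ zeta S)); apply/polyP => j.
rewrite coef_map coef_map_id0 //=.
have [|a <-] := @fixed_power_card (f_ zeta S)`_j; last by rewrite inv_iota.
by rewrite cardF -phiE -[in RHS]fix_f coef_map.
Qed.

Section LCD.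

Variables (r e : nat) (theta : {rmorphism F -> F}).
Hypothesis thetaE : forall a, theta a = a ^+ (p ^ e).

Let n := (n0 * p ^ r)%N.
Let n_gt0 : (0 < n)%N.
Proof. by rewrite muln_gt0 n0_gt0 expn_gt0 prime_gt0. Qed.

(** Evaluating tau(g) at zeta^(- p^e i) evaluates the theta-conjugate of g at
    (zeta^i)^(p^e), and that value is the p^e-th power of g(zeta^i). *)
Lemma root_conj_rev g i :
  root (map_poly iota (conj_rev n theta g)) (zeta ^+ (- (i *+ p ^ e))%R) =
  root (map_poly iota g) (zeta ^+ i).
Proof.
have [phi phiE] := power_rmorphism e pcharL.
have zn j : (zeta ^+ j)^-1 ^+ n.-1 = zeta ^+ j.
  have: (zeta ^+ j)^-1 ^+ n = 1.
    rewrite exprVn -exprM /n mulnCA exprM.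
    by rewrite (prim_expr_order zeta_prim) expr1n invr1.
  rewrite -{1}(prednK n_gt0) exprSr => /(canRL (mulfK _)) -> //.
    by rewrite mul1r invrK.
  by rewrite invr_eq0 expf_neq0 // (prim_root_eq0 zeta_prim) -lt0n.
rewrite /conj_rev map_comp_poly map_polyXn -map_poly_comp !rootE horner_comp.
rewrite hornerXn zeta_opp // zn zeta_mulrn // -phiE.
have ->: map_poly (iota \o theta) g = map_poly phi (map_poly iota g).
  rewrite -map_poly_comp; apply: eq_map_poly => a /=.
  by rewrite thetaE phiE rmorphXn.
by rewrite horner_map fmorph_eq0.
Qed.

(** By [root_conj_rev] a common zero of h and tau(g) is a zero zeta^s(i) of h
    for which zeta^i is a zero of g, where s(i) = - p^e i.  So the coprimality
    criterion is the hypothesis on zeros of [closed_roots_factor]. *)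
Lemma theta_LCD_defining_set g : g \is monic -> g %| 'X^n - 1 ->
  theta_LCD theta (ideal_code n g) <->
  exists2 S : {set residue n0}, {in S, forall i, - (i *+ p ^ e) \in S} &
    map_poly iota g = f_ zeta S ^+ (p ^ r).
Proof.
move=> mon_g dvd_g; set h := ('X^n - 1) %/ g.
have s_inj : injective (fun i : residue n0 => - (i *+ p ^ e)).
  by move=> i j /oppr_inj; apply: residue_mulrn_inj; rewrite // coprimeXl.
have def_gh : map_poly iota g * map_poly iota h =
    f_ zeta [set: residue n0] ^+ (p ^ r).
  by rewrite -rmorphM /= mulrC divpK // rmorphB /= map_polyXn rmorph1 Xn_sub1_f.
have N_gt0 : (0 < p ^ r)%N by rewrite expn_gt0 prime_gt0.
have mon_ig : map_poly iota g \is monic by rewrite map_monic.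
apply: iff_trans (closed_roots_factor zeta_prim s_inj N_gt0 mon_ig def_gh).
rewrite theta_LCD_coprime // -/h -(coprimep_map iota).
split=> [co_h i root_g|no_root].
  apply/negP => root_h; have:= coprimep_root co_h root_h.
  by rewrite -rootE root_conj_rev root_g.
apply: (@coprimep_zeta _ n0 zeta _ _ (p ^ r)).
  by rewrite -def_gh dvdp_mull.
move=> j; have [i ->] : exists i, j = - (i *+ p ^ e).
  by exists (invF s_inj j); rewrite (f_invF s_inj).
by apply: contraTN; rewrite root_conj_rev => /no_root.
Qed.

End LCD.

End DefiningSets.

(** * Stable sets of residues are unions of sigma-orbits *)

Section OrbitUnions.

Variables (q k T n0 : nat).
Hypotheses (n0_gt0 : (0 < n0)%N) (co_q_n0 : coprime q n0).
Implicit Types (i j : residue n0) (S Q R : {set residue n0}).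
Implicit Types (J : {set {set residue n0}}).

Let scale i := i *+ (q ^ k).
Let step i := - (i *+ q ^ T).
Local Notation class := (cyclotomic_class q k).
Local Notation classes := (cyclotomic_classes q k n0).
Local Notation orb := (sigma_orbit q T).

Local Notation sg := (@sigma q T n0).

(** The two covers unite first the classes of each orbit, then the residues of
    each class.  For J inside Omega the members of each family are disjoint, so
    products split along both covers. *)
Definition orbit_union J : {set residue n0} :=
  cover (cover [set orb Q | Q in J]).

Let scale_inj : injective scale.
Proof. by apply: residue_mulrn_inj; rewrite // coprimeXl. Qed.

Let step_inj : injective step.
Proof.
by move=> i j /oppr_inj; apply: residue_mulrn_inj; rewrite // coprimeXl.
Qed.

Let sigma_inj : injective sg.
Proof. exact: imset_inj step_inj. Qed.

Let mem_class i j : (j \in class i) = fconnect scale i j.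
Proof. by rewrite inE -fconnect_orbit. Qed.

Let mem_orb Q R : (R \in orb Q) = fconnect sg Q R.
Proof. by rewrite inE -fconnect_orbit. Qed.

Let class_refl i : i \in class i.
Proof. by rewrite mem_class connect0. Qed.

Let class_eq Q i : Q \in classes -> i \in Q -> Q = class i.
Proof.
case/imsetP => j _ ->; rewrite mem_class => ji.
apply/setP => x.
by rewrite !mem_class (same_connect (fconnect_sym scale_inj) ji).
Qed.

Let class_classes i : class i \in classes.
Proof. exact: imset_f. Qed.

Let class_scale i : class (scale i) = class i.
Proof. by symmetry; apply: class_eq => //; rewrite mem_class fconnect1. Qed.

(** The two multiplications commute, so sigma permutes the classes. *)
Let sigma_class i : sg (class i) = class (step i).
Proof.
have iter_step m : step (iter m scale i) = iter m scale (step i).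
  by elim: m => //= m <-; rewrite /step /scale mulNrn -!mulrnA mulnC.
apply/setP => j; apply/imsetP/idP => [[x]|]; rewrite !mem_class.
  by move=> /iter_findex <- ->; rewrite -/(step _) iter_step fconnect_iter.
move/iter_findex => <-; rewrite -iter_step.
by eexists; last by []; rewrite mem_class fconnect_iter.
Qed.

Let orb_refl Q : Q \in orb Q.
Proof. by rewrite mem_orb connect0. Qed.

Let orb_sym Q R : (R \in orb Q) = (Q \in orb R).
Proof. by rewrite !mem_orb fconnect_sym. Qed.

Let orb_eq Q R : R \in orb Q -> orb Q = orb R.
Proof.
rewrite mem_orb => QR.
by apply/setP => x; rewrite !mem_orb (same_connect (fconnect_sym sigma_inj) QR).
Qed.

Let orb_ind (P : {set residue n0} -> Prop) Q :
  (forall R, P R -> P (sg R)) -> P Q -> forall R, R \in orb Q -> P R.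
Proof.
move=> P_sigma PQ R; rewrite mem_orb => /iter_findex <-.
by elim: (findex _ _ _) => //= m; apply: P_sigma.
Qed.

Let orb_classes Q R : Q \in classes -> R \in orb Q -> R \in classes.
Proof.
move=> clQ; apply: (@orb_ind (fun P => P \in classes)) => // P /imsetP[i _ ->].
by rewrite sigma_class.
Qed.

Variable Omega : {set {set residue n0}}.
Hypothesis Omega_reps : orbit_representatives q k T Omega.

Let Omega_classes Q : Q \in Omega -> Q \in classes.
Proof. by case/andP: Omega_reps => /subsetP sub _; apply: sub. Qed.

Let Omega_rep Q : Q \in classes -> exists2 R, R \in Omega & R \in orb Q.
Proof.
move=> clQ; have /andP[_ /forall_inP/(_ _ clQ)/cards1P[R defR]] := Omega_reps.
have : R \in Omega :&: orb Q by rewrite defR inE.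
by case/setIP; exists R.
Qed.

Let Omega_inj Q R : Q \in Omega -> R \in Omega -> R \in orb Q -> Q = R.
Proof.
move=> OQ OR QR; have clQ := Omega_classes OQ.
have /andP[_ /forall_inP/(_ _ clQ)/cards1P[P defP]] := Omega_reps.
have /set1P-> : R \in [set P] by rewrite -defP inE OR.
by apply/set1P; rewrite -defP inE OQ orb_refl.
Qed.

Lemma mem_orbit_union J i : J \subset Omega ->
  reflect (exists2 Q, Q \in J & class i \in orb Q) (i \in orbit_union J).
Proof.
move=> /subsetP sJ; apply: (iffP bigcupP) => [[R]|[Q JQ Qi]].
  case/bigcupP => _ /imsetP[Q JQ ->] QR Ri; exists Q => //.
  by rewrite -(class_eq _ Ri) //; apply: orb_classes QR; apply/Omega_classes/sJ.
by exists (class i) => //; apply/bigcupP; exists (orb Q); rewrite ?imset_f.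
Qed.

Lemma orbit_union_scale J : J \subset Omega ->
  {in orbit_union J, forall i, i *+ q ^ k \in orbit_union J}.
Proof.
move=> sJ i /(mem_orbit_union _ sJ)[Q JQ Qi]; apply/mem_orbit_union => //.
by exists Q => //; rewrite class_scale.
Qed.

Lemma orbit_union_step J : J \subset Omega ->
  {in orbit_union J, forall i, - (i *+ q ^ T) \in orbit_union J}.
Proof.
move=> sJ i /(mem_orbit_union _ sJ)[Q JQ Qi]; apply/mem_orbit_union => //.
exists Q => //; rewrite -sigma_class mem_orb.
by apply: connect_trans (fconnect1 _ _); rewrite -mem_orb.
Qed.

(** Such an S contains the whole class of each of its elements and the whole
    sigma-orbit of each class inside it, hence also the representative of that
    orbit. *)
Lemma closed_orbit_union S :
    {in S, forall i, i *+ q ^ k \in S} ->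
    {in S, forall i, - (i *+ q ^ T) \in S} ->
  S = orbit_union [set Q in Omega | Q \subset S].
Proof.
move=> scaleS stepS; set J := [set Q in _ | _].
have sJ : J \subset Omega by apply/subsetP => Q; rewrite inE => /andP[].
have orbS Q R : R \in orb Q -> Q \subset S -> R \subset S.
  move=> QR sQ; apply: (@orb_ind (fun P => P \subset S) Q) QR => //.
  move=> {}R /subsetP sR.
  by apply/subsetP => _ /imsetP[i Ri ->]; apply/stepS/sR.
apply/setP => i; apply/idP/(mem_orbit_union _ sJ) => [Si|[Q]].
  have sI : class i \subset S.
    apply/subsetP => j; rewrite mem_class => /iter_findex <-.
    by elim: (findex _ _ _) => //= m; apply: scaleS.
  have [Q OQ iQ] := Omega_rep (class_classes i).
  by exists Q; rewrite 1?orb_sym // inE OQ (orbS _ _ iQ).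
by rewrite inE => /andP[_ sQ] /orbS/(_ sQ)/subsetP; apply.
Qed.

(** J can be recovered from the union of its orbits, since a representative
    inside that union lies in the orbit of an element of J and so equals
    it. *)
Lemma sub_orbit_union J : J \subset Omega ->
  [set Q in Omega | Q \subset orbit_union J] = J.
Proof.
move=> sJ; apply/setP => Q; rewrite inE; apply/andP/idP => [[OQ sQ]|JQ].
  have /imsetP[i _ defQ] := Omega_classes OQ.
  have /(subsetP sQ)/(mem_orbit_union _ sJ)[R JR] : i \in Q by rewrite defQ.
  by rewrite -defQ => /Omega_inj <- //; apply: (subsetP sJ).
have OQ := subsetP sJ _ JQ; split=> //; apply/subsetP => i Qi.
apply/mem_orbit_union => //; exists Q => //.
by rewrite -(class_eq _ Qi) // Omega_classes.
Qed.

(** Distinct classes are disjoint, and so are distinct orbits of classes; the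
    product over the union splits twice. *)
Lemma f_orbit_union (L : fieldType) (zeta : L) J : J \subset Omega ->
  f_ zeta (orbit_union J) = \prod_(Q in J) F_ q T zeta Q.
Proof.
move=> sJ; have classJ R : R \in cover [set orb Q | Q in J] -> R \in classes.
  case/bigcupP => _ /imsetP[Q JQ ->]; apply: orb_classes.
  exact/Omega_classes/(subsetP sJ).
rewrite /f_ /orbit_union big_trivIset /=; last first.
  apply/trivIsetP => Q R /classJ clQ /classJ clR; apply: contraR.
  case/pred0Pn => i /andP[/= Qi Ri].
  by rewrite (class_eq clQ Qi) -(class_eq clR Ri).
rewrite big_trivIset /=; last first.
  apply/trivIsetP => _ _ /imsetP[Q _ ->] /imsetP[R _ ->]; apply: contraR.
  case/pred0Pn => P /andP[/= QP RP].
  by rewrite (orb_eq QP) -(orb_eq RP).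
rewrite big_imset // => Q R JQ JR eqQR.
by apply: Omega_inj; rewrite ?(subsetP sJ) // eqQR.
Qed.

Lemma F_orbit1 (L : fieldType) (zeta : L) Q :
  #|orb Q| = 1%N -> F_ q T zeta Q = f_ zeta Q.
Proof.
move/eqP/cards1P => [R defR]; rewrite /F_ defR big_set1.
by have:= orb_refl Q; rewrite defR => /set1P->.
Qed.

Lemma Omega12_disjoint : [disjoint Omega1 q T Omega & Omega2 q T Omega].
Proof.
apply/pred0P => Q /=; rewrite !inE; apply/negP => /andP[/andP[_ /eqP->]].
by rewrite andbF.
Qed.

Lemma Omega12_cover : Omega1 q T Omega :|: Omega2 q T Omega = Omega.
Proof.
apply/setP => Q; rewrite !inE -andb_orr; case: (Q \in Omega) => //=.
by rewrite eq_sym -leq_eqVlt card_gt0; apply/set0Pn; exists Q; apply: orb_refl.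
Qed.

Lemma prod_Omega12 (L : fieldType) (zeta : L) N J1 J2 :
    J1 \subset Omega1 q T Omega -> J2 \subset Omega2 q T Omega ->
  (\prod_(Q in J1) f_ zeta Q ^+ N) * (\prod_(Q in J2) F_ q T zeta Q ^+ N) =
  f_ zeta (orbit_union (J1 :|: J2)) ^+ N.
Proof.
move=> sJ1 sJ2; have sJ : J1 :|: J2 \subset Omega.
  by rewrite -Omega12_cover setUSS.
have disJ : [disjoint J1 & J2].
  exact: disjointWl sJ1 (disjointWr sJ2 Omega12_disjoint).
rewrite f_orbit_union // -[RHS]prodrXl [RHS](bigID (mem J1)) /=; congr (_ * _).
  apply: eq_big => Q.
    by rewrite inE andbC orbC; case: (Q \in J1); rewrite ?orbT.
  by move/(subsetP sJ1); rewrite inE => /andP[_ /eqP/F_orbit1->].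
apply: eq_bigl => Q; rewrite inE andb_orl andbN /=.
by case: (boolP (Q \in J2)) => // J2Q; rewrite (disjointFl disJ).
Qed.

Lemma card_Omega12 : #|Omega| = (#|Omega1 q T Omega| + #|Omega2 q T Omega|)%N.
Proof.
rewrite -{1}Omega12_cover cardsU disjoint_setI0 ?cards0 ?subn0 //.
exact: Omega12_disjoint.
Qed.

End OrbitUnions.

(** * Classification and count *)

Lemma eq_theta_LCD (F : finFieldType) n (theta1 theta2 : F -> F)
  (C : {set 'rV[F]_n}) :
  theta1 =1 theta2 -> theta_LCD theta1 C = theta_LCD theta2 C.
Proof.
move=> eq_theta; rewrite /theta_LCD; congr (_ :&: _ == _); apply/setP => v.
rewrite !inE; apply: eq_forallb => c; congr (_ ==> (_ == _)).
by apply: eq_bigr => i _; rewrite eq_theta.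
Qed.

Theorem theorem30 (p m q k T n0 r n : nat)
  (F : finFieldType) (L : fieldType) (iota : {rmorphism F -> L}) (zeta : L)
  (Omega : {set {set residue n0}})
  (p_prime : prime p) (m_gt0 : (0 < m)%N) (q_def : q = (p ^ m)%N)
  (lt_T_k : (T < k)%N) (card_F : #|F| = (q ^ k)%N)
  (n0_gt0 : (0 < n0)%N) (co_n0_p : coprime n0 p) (n_def : n = (n0 * p ^ r)%N)
  (zeta_prim : n0.-primitive_root zeta)
  (Omega_reps : orbit_representatives q k T Omega) :
  (forall (C : {set 'rV[F]_n}) (g : {poly F}),
     cyclic_code C -> generator_poly C g ->
     (theta_LCD (frob q T) C <->
      exists J1 J2 : {set {set residue n0}},
        [/\ J1 \subset Omega1 q T Omega, J2 \subset Omega2 q T Omega &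
          map_poly iota g =
            (\prod_(Q in J1) f_ zeta Q ^+ (p ^ r)) *
            (\prod_(Q in J2) F_ q T zeta Q ^+ (p ^ r))])) /\
  #|[set C : {set 'rV[F]_n} | cyclic_code C & theta_LCD (frob q T) C]| =
    (2 ^ (#|Omega1 q T Omega| + #|Omega2 q T Omega|))%N.
Proof.
have co_q_n0 : coprime q n0 by rewrite q_def coprimeXl // coprime_sym.
have cardF : #|F| = (p ^ (m * k))%N by rewrite card_F q_def expnM.
have pr_gt0 : (0 < p ^ r)%N by rewrite expn_gt0 prime_gt0.
have n_gt0 : (0 < n)%N by rewrite n_def muln_gt0 n0_gt0.
have co_p_n0 : coprime p n0 by rewrite coprime_sym.
have [theta thetaE] := power_rmorphism (m * T) (card_finPcharP cardF p_prime).
(* The sets J1 and J2 of the statement are the parts of J in Omega1 and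
   Omega2. *)
have LCD_iff g : g \is monic -> g %| 'X^n - 1 ->
    theta_LCD (frob q T) (ideal_code n g) <->
    exists2 J : {set {set residue n0}}, J \subset Omega &
      map_poly iota g = f_ zeta (orbit_union q T J) ^+ (p ^ r).
  move=> mon_g dvd_g; rewrite (@eq_theta_LCD _ _ _ theta); last first.
    by move=> a; rewrite thetaE /frob q_def expnM.
  have LCD_set : theta_LCD theta (ideal_code n g) <->
      exists2 S : {set residue n0}, {in S, forall i, - (i *+ q ^ T) \in S} &
        map_poly iota g = f_ zeta S ^+ (p ^ r).
    subst n q; rewrite -expnM.
    exact: (theta_LCD_defining_set iota p_prime cardF zeta_prim co_p_n0 thetaE).
  apply: iff_trans LCD_set _; split=> [[S stepS def_g] | [J sJ def_g]].
    have scaleS : {in S, forall i, i *+ q ^ k \in S}.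
      move=> i Si.
      rewrite -(root_f zeta_prim) -(root_pexp _ _ pr_gt0) -def_g -card_F.
      apply: (root_map_mulrn_card p_prime cardF zeta_prim).
      by rewrite def_g root_pexp // root_f.
    exists [set Q in Omega | Q \subset S].
      by apply/subsetP => Q; rewrite inE => /andP[].
    by rewrite -(closed_orbit_union n0_gt0 co_q_n0 Omega_reps scaleS stepS).
  exists (orbit_union q T J) => //.
  exact: (orbit_union_step n0_gt0 co_q_n0 Omega_reps sJ).
split=> [C g _ [mon_g dvd_g ->]|].
  apply: iff_trans (LCD_iff g mon_g dvd_g) _.
  split=> [[J sJ ->] | [J1 [J2 [sJ1 sJ2 ->]]]].
    exists (J :&: Omega1 q T Omega), (J :&: Omega2 q T Omega).
    rewrite !subsetIr; split=> //.
    rewrite (prod_Omega12 n0_gt0 co_q_n0 Omega_reps) ?subsetIr //.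
    by rewrite -setIUr Omega12_cover (setIidPl sJ).
  exists (J1 :|: J2); first by rewrite -(Omega12_cover q T Omega) setUSS.
  by rewrite (prod_Omega12 n0_gt0 co_q_n0 Omega_reps).
rewrite -card_Omega12 -card_powerset.
(* The codes are counted through the bijection that sends a subset J of Omega
   to the code generated by gen J. *)
have gen_ex (J : {set {set residue n0}}) : exists g : {poly F},
    J \subset Omega -> map_poly iota g = f_ zeta (orbit_union q T J) ^+ (p ^ r).
  case sJ: (J \subset Omega); last by exists 0.
  have scaleJ :
      {in orbit_union q T J, forall i, i *+ #|F| \in orbit_union q T J}.
    by rewrite card_F; apply: (orbit_union_scale n0_gt0 co_q_n0 Omega_reps sJ).
  have [g def_g] := f_descent iota p_prime cardF zeta_prim co_p_n0 scaleJ.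
  by exists (g ^+ (p ^ r)) => _; rewrite rmorphXn /= def_g.
have [gen genP] := fin_all_exists gen_ex.
have gen_mon (J : {set {set residue n0}}) : J \subset Omega -> gen J \is monic.
  by move=> sJ; rewrite -(map_monic iota) genP // monic_exp // f_monic.
have gen_dvd (J : {set {set residue n0}}) :
    J \subset Omega -> gen J %| 'X^n - 1.
  move=> sJ; rewrite -(dvdp_map iota) genP //.
  rewrite rmorphB /= map_polyXn rmorph1 n_def.
  rewrite (Xn_sub1_f iota p_prime cardF zeta_prim).
  by rewrite -(f_compl zeta (orbit_union q T J)) exprMn dvdp_mulr.
have code_inj :
    {in powerset Omega &, injective (fun J => ideal_code n (gen J))}.
  move=> J J'; rewrite !inE => sJ sJ' /ideal_code_inj eq_gen.
  have /(congr1 (map_poly iota)) : gen J = gen J' by apply: eq_gen; auto.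
  rewrite !genP // => eq_f.
  rewrite -(sub_orbit_union n0_gt0 co_q_n0 Omega_reps sJ).
  rewrite -(sub_orbit_union n0_gt0 co_q_n0 Omega_reps sJ').
  suff -> : orbit_union q T J = orbit_union q T J' by [].
  apply/setP => i; rewrite -!(root_f zeta_prim) -(root_pexp _ _ pr_gt0) eq_f.
  by rewrite root_pexp.
rewrite -(card_in_imset code_inj); apply: eq_card => C; rewrite !inE.
apply/andP/imsetP => [[cycC] | [J]].
  have [g [mon_g dvd_g ->]] := cyclic_code_generator n_gt0 cycC.
  move/(LCD_iff g mon_g dvd_g) => [J sJ def_g]; exists J; first by rewrite inE.
  by congr (ideal_code n _); apply: (map_poly_inj iota); rewrite genP.
rewrite inE => sJ ->; split; first exact: ideal_code_cyclic (gen_dvd J sJ).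
by apply/LCD_iff; auto; exists J; auto.
Qed.
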